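(* Let $V$ be a complex Hilbert space. For $u \in SV_{\mathbf{C}}'$ let $U : SV \to SV'$ be defined by $$[U\phi](\psi) = u(\psi_{+}\phi_{-}) \qquad (\phi,\psi \in SV).$$ Then $u \mapsto U$ is a well-defined linear isomorphism $$SV_{\mathbf{C}}' \longrightarrow \mathrm{Hom}(SV, SV')$$ onto the complex vector space of all linear maps $SV \to SV'$.
   Context: Inner products are antilinear in the first slot and linear in the second. For a complex vector space $W$, $SW = \bigoplus_{n\ge 0} S^nW$ is the (algebraic) symmetric algebra and $SW'$ is its full antidual: the complex vector space of all antilinear functionals $SW \to \mathbf{C}$. Let $J$ denote multiplication by $i$ on $V$, viewed as a real-linear operator, and $\Omega = \mathrm{Im}\langle\cdot|\cdot\rangle$. Let $V_{\mathbf{C}} = \mathbf{C}\otimes_{\mathbf{R}} V$ be the complexification of the real vector space underlying $V$, and let $J_{\mathbf{C}}$, $\Omega_{\mathbf{C}}$ be the complex-(bi)linear extensions of $J$, $\Omega$. Then $V_{\mathbf{C}} = V_{+}\oplus V_{-}$, where $J_{\mathbf{C}} = \pm i I$ on $V_{\pm}$. For $v \in V$ put $v_{+} = \frac{1}{\sqrt2}(v - iJv) \in V_{+}$ and $v_{-} = \frac{1}{\sqrt2}(v + iJv)\in V_{-}$ (here $i$ is the scalar of $V_{\mathbf{C}}$); $v\mapsto v_+$ is a complex-linear bijection $V\to V_+$ and $v\mapsto v_-$ is an antilinear bijection $V\to V_-$. These extend to a linear algebra isomorphism $SV \to S(V_{+})\subset SV_{\mathbf{C}}$, $\psi\mapsto\psi_{+}$,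 and an antilinear multiplicative bijection $SV\to S(V_{-})\subset SV_{\mathbf{C}}$, $\phi\mapsto\phi_{-}$. The product $\psi_{+}\phi_{-}$ is taken in $SV_{\mathbf{C}} \equiv S(V_+)\otimes S(V_-)$. *)

(* Defs.v *)
From HB Require Import structures.
From mathcomp Require Import all_boot all_order all_algebra.
From mathcomp Require Import ring_quotient generic_quotient complex.
From mathcomp Require Import boolp classical_sets functions reals topology.
From mathcomp Require Import normedtype.
From mathcomp Require Import finmap.
(* The notations of monalg clash with those of mathcomp-analysis. *)
From mathcomp.multinomials Require Import -(notations) monalg.

Set Implicit Arguments.
Unset Strict Implicit.
Unset Printing Implicit Defensive.

Import GRing.Theory Num.Theory numFieldNormedType.Exports.

Local Open Scope ring_scope.
Local Open Scope quotient_scope.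

(* Antilinearity of inner in its first argument follows from the first two
   axioms; positive definiteness follows from the third. *)
HB.mixin Record isComplexHilbert (R : realType) V
    of CompleteNormedModule R[i] V := {
  inner : V -> V -> R[i];
  inner_linearr : forall u a v w,
    inner u (a *: v + w) = a * inner u v + inner u w;
  inner_conj : forall u v, inner u v = (inner v u)^*;
  inner_norm : forall v, inner v v = `|v| ^+ 2
}.

#[short(type="complexHilbertType")]
HB.structure Definition ComplexHilbert (R : realType) :=
  {V of isComplexHilbert R V & CompleteNormedModule R[i] V}.

(* {f : U -> M | f (a *: u + v) = s a *: f u + f v}, with pointwise
   operations. *)
Section SemilinearMaps.
Variables (K : comNzRingType) (s : {rmorphism K -> K}) (U M : lmodType K).

Definition semilinear_fun : {pred U -> M} :=
  fun f => `[< forall a u v, f (a *: u + v) = s a *: f u + f v >].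

Record semihom := Semihom {
  semihom_fun :> U -> M;
  semihom_funP : semihom_fun \in semilinear_fun
}.

HB.instance Definition _ := [isSub for semihom_fun].
HB.instance Definition _ := [Choice of semihom by <:].

Lemma semilinear_fun_submod : submod_closed semilinear_fun.
Proof.
split=> [|a f g /asboolP lf /asboolP lg]; apply/asboolP => b u v.
  by rewrite scaler0 addr0.
have E w : (a *: f + g) w = a *: f w + g w by [].
rewrite !E lf lg !scalerDr !scalerA [s b * a]mulrC !addrA.
by congr (_ + _); rewrite -!addrA; congr (_ + _); exact: addrC.
Qed.

HB.instance Definition _ :=
  GRing.isSubmodClosed.Build K (U -> M) semilinear_fun semilinear_fun_submod.
HB.instance Definition _ := [SubChoice_isSubLmodule of semihom by <:].

Lemma semihomP (f : semihom) a u v : f (a *: u + v) = s a *: f u + f v.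
Proof. by have /asboolP := semihom_funP f; apply. Qed.

HB.instance Definition _ (f : semihom) :=
  GRing.isLinear.Build K U M (s \; *:%R) (semihom_fun f) (semihomP f).

End SemilinearMaps.

Notation linHom U M := (semihom idfun U M).

Definition antidual (R : realType) (W : lmodType R[i]) :=
  semihom Num.conj W (R[i])^o.

Section SymmetricAlgebra.
Variables (K : fieldType) (W : lmodType K).

(* The polynomial algebra K[W] whose indeterminates are the vectors of W. *)
Local Notation freecomalg := (malg (cmonom W) K).

Definition freecomvar (w : W) : freecomalg := mkmalgU (ucm w) 1.

(* The ideal of K[W] generated by the X_(a v + w) - a X_v - X_w. *)
Inductive linear_relations : freecomalg -> Prop :=
| linear_relations0 : linear_relations 0
| linear_relationsD (p q : freecomalg) (a : K) (v w : W) :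
    linear_relations q ->
    linear_relations (p * (freecomvar (a *: v + w)
                           - (a *: freecomvar v + freecomvar w)) + q).

Definition sym_ideal : {pred freecomalg} := fun p => `[< linear_relations p >].

Lemma sym_ideal_closed : idealr_closed sym_ideal.
Proof.
split.
- exact/asboolP/linear_relations0.
- apply/asboolP => H.
  suff : mcoeff (@mone (cmonom W)) (1 : freecomalg) = 0.
    by move/eqP; rewrite mcoeff1 eqxx oner_eq0.
  elim: H => [|p q a v w _ IH]; first by rewrite raddf0.
  have e0 u : mcoeff (@mone (cmonom W)) (freecomvar u) = 0.
    by rewrite mcoeffU cm1_eq1 mulr0n.
  have [eM _] := @mcoeff1g_is_multiplicative (cmonom W) K.
  rewrite mcoeffD eM mcoeffB mcoeffD mcoeffZ IH.
  move: (freecomvar v) (freecomvar w) (freecomvar _) (e0 v) (e0 w)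
    (e0 (a *: v + w)) => x y z -> -> ->.
  by rewrite mulr0 !addr0 subr0 mulr0.
- move=> a u v /asboolP Hu /asboolP Hv; apply/asboolP.
  elim: Hu => [|p q b x y _ IH]; first by rewrite mulr0 add0r.
  by rewrite mulrDr mulrA -addrA; apply: linear_relationsD.
Qed.

HB.instance Definition _ := isIdealr.Build freecomalg sym_ideal sym_ideal_closed.

Definition symalg := {ideal_quot sym_ideal}.
HB.instance Definition _ := GRing.ComNzRing.on symalg.


Definition sym_pi (p : freecomalg) : symalg := \pi_symalg p.

Lemma sym_pi_zmod : zmod_morphism sym_pi.
Proof. exact: pi_is_zmod_morphism. Qed.

Lemma sym_pi_monoid : monoid_morphism sym_pi.
Proof. exact: pi_is_monoid_morphism. Qed.

HB.instance Definition _ :=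
  GRing.isZmodMorphism.Build freecomalg symalg sym_pi sym_pi_zmod.
HB.instance Definition _ :=
  GRing.isMonoidMorphism.Build freecomalg symalg sym_pi sym_pi_monoid.

Definition sym_scale (a : K) (x : symalg) : symalg := sym_pi a%:A * x.

Lemma sym_scaleA a b x : sym_scale a (sym_scale b x) = sym_scale (a * b) x.
Proof.
have E : (a * b)%:A = a%:A * b%:A :> freecomalg.
  exact: (rmorphM (in_alg freecomalg)).
by rewrite /sym_scale E (rmorphM sym_pi); exact: mulrA.
Qed.

Lemma sym_scale1 : left_id 1 sym_scale.
Proof. by move=> x; rewrite /sym_scale scale1r (rmorph1 sym_pi) mul1r. Qed.

Lemma sym_scaleDr : right_distributive sym_scale +%R.
Proof. by move=> a x y; rewrite /sym_scale mulrDr. Qed.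

Lemma sym_scaleDl x : {morph sym_scale^~ x : a b / a + b}.
Proof. by move=> a b; rewrite /sym_scale scalerDl (rmorphD sym_pi) mulrDl. Qed.

HB.instance Definition _ := GRing.Zmodule_isLmodule.Build K symalg
  sym_scaleA sym_scale1 sym_scaleDr sym_scaleDl.

Lemma sym_scaleAl (a : K) (x y : symalg) : a *: (x * y) = (a *: x) * y.
Proof. exact: mulrA. Qed.

HB.instance Definition _ := GRing.Lmodule_isLalgebra.Build K symalg sym_scaleAl.
HB.instance Definition _ := GRing.Lalgebra_isComAlgebra.Build K symalg.

Definition sym_gen (w : W) : symalg := sym_pi (freecomvar w).

Lemma sym_piZ (a : K) (p : freecomalg) : sym_pi (a *: p) = a *: sym_pi p.
Proof. by rewrite -{1}[p]mul1r scalerAl rmorphM. Qed.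

Lemma sym_gen_linear : linear sym_gen.
Proof.
move=> a v w; rewrite /sym_gen -sym_piZ -rmorphD; apply/eqP.
rewrite -Quotient.idealrBE; apply/asboolP.
by rewrite -[X in linear_relations X]addr0 -[X in X + 0]mul1r;
  apply: linear_relationsD; exact: linear_relations0.
Qed.

HB.instance Definition _ :=
  GRing.isLinear.Build K W symalg *:%R sym_gen sym_gen_linear.

End SymmetricAlgebra.

Arguments sym_ideal {K W} p.
Arguments sym_pi {K W} p.

(* The ring morphism S W -> A equal to s on scalars and to f on W; meaningful
   when f is additive and s-homogeneous. *)
Section Lift.
Variables (K : fieldType) (W : lmodType K) (A : comNzRingType).
Variables (s : {rmorphism K -> A}) (f : W -> A).

Definition monom_eval (m : cmonom W) : A := \prod_(w <- finsupp m) f w ^+ m w.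

Definition sym_lift (x : symalg W) : A := mmap s monom_eval (repr x).

Lemma monom_evalE (d : {fset W}) (m : cmonom W) :
  fsubset (finsupp m) d -> monom_eval m = \prod_(w <- d) f w ^+ m w.
Proof.
move=> md; rewrite /monom_eval (big_fset_incl _ md) // => w _.
by rewrite -cmE_neq0 negbK => /eqP ->.
Qed.

Lemma monom_eval_mmorphism : mmorphism monom_eval.
Proof.
split=> [m n|]; last by rewrite /monom_eval mdom1 big_seq_fset0.
rewrite (@monom_evalE (fsetU (finsupp m) (finsupp n)) m) ?fsubsetUl //.
rewrite (@monom_evalE (fsetU (finsupp m) (finsupp n)) n) ?fsubsetUr //.
rewrite /monom_eval mdomD -big_split /=.
by apply: eq_bigr => w _; rewrite cmM exprD.
Qed.

HB.instance Definition _ :=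
  isMultiplicative.Build (cmonom W) A monom_eval monom_eval_mmorphism.

Lemma monom_evalU w : monom_eval (ucm w) = f w.
Proof. by rewrite /monom_eval mdomU big_seq_fset1 cmUU expr1. Qed.

Hypothesis fL : forall a v w, f (a *: v + w) = s a * f v + f w.

Lemma sym_lift_pi p : sym_lift (sym_pi p) = mmap s monom_eval p.
Proof.
pose F : {rmorphism malg (cmonom W) K -> A} := mmap s monom_eval.
have Fvar w : F (freecomvar w) = f w.
  by rewrite /F /= mmapU monom_evalU /= rmorph1 mul1r.
have F0 q : linear_relations q -> F q = 0.
  elim=> [|{}q r a v w _ IH]; first exact: rmorph0.
  rewrite rmorphD rmorphM rmorphB rmorphD IH addr0.
  rewrite [F (a *: _)]mmapZ -[mmap _ _ _]/(F _).
  move: (freecomvar v) (freecomvar w) (freecomvar _) (Fvar v) (Fvar w)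
    (Fvar (a *: v + w)) => x y z -> -> ->.
  by rewrite fL subrr mulr0.
apply/eqP; rewrite -subr_eq0 -[mmap _ _ p]/(F p) -[sym_lift _]/(F _) -rmorphB.
apply/eqP/F0.
suff : repr (sym_pi p) - p \in sym_ideal by move/asboolP.
by rewrite Quotient.idealrBE reprK.
Qed.

Lemma sym_lift_zmod : zmod_morphism sym_lift.
Proof.
move=> x y; rewrite -[x]reprK -[y]reprK -!/(sym_pi _) -(rmorphB sym_pi).
by rewrite !sym_lift_pi; exact: rmorphB.
Qed.

Lemma sym_lift_monoid : monoid_morphism sym_lift.
Proof.
split=> [|x y]; first by rewrite -(rmorph1 sym_pi) sym_lift_pi; exact: rmorph1.
rewrite -[x]reprK -[y]reprK -!/(sym_pi _) -(rmorphM sym_pi).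
by rewrite !sym_lift_pi; exact: rmorphM.
Qed.

Lemma sym_liftZ a x : sym_lift (a *: x) = s a * sym_lift x.
Proof.
rewrite -[x]reprK -!/(sym_pi _) -sym_piZ !sym_lift_pi; exact: mmapZ.
Qed.

Lemma sym_lift_gen w : sym_lift (sym_gen w) = f w.
Proof. by rewrite sym_lift_pi mmapU monom_evalU /= rmorph1 mul1r. Qed.

End Lift.

Lemma sym_lift_unique (K : fieldType) (W : lmodType K) (A : comNzRingType)
    (g h : {rmorphism symalg W -> A}) :
  (forall a : K, g a%:A = h a%:A) ->
  (forall w, g (sym_gen w) = h (sym_gen w)) -> g =1 h.
Proof.
move=> gh0 gh1 x; rewrite -[x]reprK -/(sym_pi _); move: (repr x) => {x} p.
have UM (k m : cmonom W) : mkmalgU (mmul k m) 1 = mkmalgU k 1 * mkmalgU m 1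
    :> malg (cmonom W) K.
  by rewrite malgM_def fgmulUU mulr1.
have ghU (k : cmonom W) : g (sym_pi (mkmalgU k 1)) = h (sym_pi (mkmalgU k 1)).
  have [n] := ubnP (mdeg k); elim: n k => // n IH k.
  have [-> _|] := eqVneq k mone.
    by rewrite -[mkmalgU _ _]/(1 : malg (cmonom W) K) (rmorph1 sym_pi) !rmorph1.
  have [/eqP|/fset0Pn [w wk]] := eqVneq (finsupp k) fset0.
    move/eqP => k0; have -> : k = mone by apply: mdeg_eq0I; rewrite mdegE k0 big_seq_fset0.
    by rewrite eqxx.
  have -> : k = mmul (ucm w) (divcm k (ucm w)).
    apply/eqP/cmP => i; rewrite cmM divcmE cmU subnKC //.
    by case: eqP => // <-; rewrite lt0n cmE_neq0.
  rewrite mdegM mdegU => _ H; have e2 := IH _ H.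
  have e1 : g (sym_pi (mkmalgU (ucm w) 1)) = h (sym_pi (mkmalgU (ucm w) 1)).
    exact: gh1.
  rewrite (UM (ucm w) _).
  move: (mkmalgU (ucm w) 1) (mkmalgU (divcm k _) 1) e1 e2 => X Y e1 e2.
  by rewrite (rmorphM sym_pi) (rmorphM g) (rmorphM h) e1 e2.
rewrite (monalgE p) (rmorph_sum sym_pi) !rmorph_sum /=.
apply: eq_bigr => k _.
have -> : mkmalgU k (mcoeff k p) = (mcoeff k p) *: mkmalgU k 1
    :> malg (cmonom W) K.
  move: (mcoeff k p) => c; apply/malgP => m.
  apply: etrans (mcoeffU k c m) _; apply/esym.
  apply: etrans (mcoeffZ c _ m) _.
  apply: etrans (congr1 ( *%R c) (mcoeffU k 1 m)) _.
  by rewrite mulrnAr mulr1.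
move: (mkmalgU k 1) (ghU k) => X eX.
by rewrite sym_piZ -mulr_algl (rmorphM g) (rmorphM h) gh0 eX.
Qed.

Section Realification.
Variables (R : realType) (V : lmodType R[i]).

Definition realification : Type := V.
HB.instance Definition _ := GRing.Zmodule.copy realification V.

Definition real_scale (a : R) (v : realification) : realification :=
  (a%:C)%C *: (v : V).

Lemma real_scaleA a b v : real_scale a (real_scale b v) = real_scale (a * b) v.
Proof. by rewrite /real_scale scalerA -rmorphM. Qed.

Lemma real_scale1 : left_id 1 real_scale.
Proof. exact: scale1r. Qed.

Lemma real_scaleDr : right_distributive real_scale +%R.
Proof. by move=> a u v; exact: scalerDr. Qed.

Lemma real_scaleDl v : {morph real_scale^~ v : a b / a + b}.
Proof. by move=> a b; rewrite /real_scale rmorphD; exact: scalerDl. Qed.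

HB.instance Definition _ := GRing.Zmodule_isLmodule.Build R realification
  real_scaleA real_scale1 real_scaleDr real_scaleDl.

Definition Jop (v : realification) : realification := 'i *: (v : V).

Lemma Jop_linear : linear Jop.
Proof.
move=> a u v; rewrite /Jop [LHS]scalerDr; congr (_ + _).
by rewrite [LHS]scalerA mulrC -[LHS]scalerA.
Qed.

End Realification.

(* The complexification C (x)_R E, with (x, y) standing for
   1 (x) x + i (x) y. *)
Section Complexification.
Variables (R : realType) (E : lmodType R).

Definition complexification : Type := (E * E)%type.
HB.instance Definition _ := GRing.Zmodule.copy complexification (E * E)%type.

Definition cplx_scale (a : R[i]) (e : complexification) : complexification :=
  (complex.Re a *: e.1 - complex.Im a *: e.2,
   complex.Re a *: e.2 + complex.Im a *: e.1).

Lemma cplx_scaleA a b e : cplx_scale a (cplx_scale b e) = cplx_scale (a * b) e.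
Proof.
case: a b e => [a1 a2] [b1 b2] [x y]; rewrite /cplx_scale /=; congr (_, _);
  rewrite !(scalerDr, scalerN, scalerA, scalerBl, scalerDl).
- by rewrite !opprD -!addrA; congr (_ + _); rewrite addrA; exact: addrC.
- by rewrite -!addrA; congr (_ + _); rewrite addrA; exact: addrC.
Qed.

Lemma cplx_scale1 : left_id 1 cplx_scale.
Proof.
by case=> x y; rewrite /cplx_scale /= !scale1r !scale0r subr0 addr0.
Qed.

Lemma cplx_scaleDr : right_distributive cplx_scale +%R.
Proof.
move=> a [x y] [z t]; rewrite /cplx_scale /=; congr (_, _);
  by rewrite !scalerDr ?opprD addrACA.
Qed.

Lemma cplx_scaleDl e : {morph cplx_scale^~ e : a b / a + b}.
Proof.
move: e => [x y] [a1 a2] [b1 b2]; rewrite /cplx_scale /=; congr (_, _);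
  by rewrite !scalerDl ?opprD addrACA.
Qed.

HB.instance Definition _ := GRing.Zmodule_isLmodule.Build R[i] complexification
  cplx_scaleA cplx_scale1 cplx_scaleDr cplx_scaleDl.

Definition cplx_in (x : E) : complexification := (x, 0).

Lemma cplx_inE x y : (x, y) = cplx_in x + 'i *: cplx_in y :> complexification.
Proof.
rewrite -complexiE; congr (_, _); rewrite /= ?scaler0 ?scale0r ?scale1r.
  by rewrite subr0 addr0.
by rewrite !add0r.
Qed.

End Complexification.

Lemma complexification_universal (R : realType) (E : lmodType R)
    (M : lmodType R[i]) (f : {linear E -> realification M}) :
  exists2 g : {linear complexification E -> M},
    (forall x, g (cplx_in x) = f x) &
    forall h : {linear complexification E -> M},
      (forall x, h (cplx_in x) = f x) -> h =1 g.
Proof.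
pose g (e : complexification E) : M := f e.1 + 'i *: (f e.2 : M).
have gL : linear g.
  have fZ (r : R) z : f (r *: z) = (r%:C)%C *: (f z : M) :> M.
    exact: (linearZ_LR f).
  have fD z t : f (z + t) = (f z : M) + f t :> M by exact: raddfD.
  have fN z : f (- z) = - (f z : M) :> M by exact: raddfN.
  move=> a [x y] [x' y'].
  rewrite /g /= !fD fN !fZ [in RHS](complexE a) complexiE.
  move: (f x : M) (f y : M) (f x' : M) (f y' : M) => A B A' B'.
  move: ((complex.Re a)%:C)%C ((complex.Im a)%:C)%C => r m.
  rewrite [X in _ + X = _]scalerDr addrACA; congr (_ + _).
  rewrite !scalerDl !scalerDr !scalerA [r * 'i]mulrC.
  have -> : 'i * m * 'i = - m by rewrite mulrAC -expr2 sqrCi mulN1r.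
  by rewrite scaleNr -!addrA; congr (_ + _); rewrite addrC -addrA.
pose gM := GRing.isLinear.Build R[i] (complexification E) M *:%R g gL.
pose gl : {linear complexification E -> M} := HB.pack g gM.
exists gl.
  by move=> x; rewrite /= /g /= linear0 [_ *: _]scaler0 addr0.
move=> h hf [x y]; rewrite {1}cplx_inE linearD linearZ /= !hf.
by [].
Qed.

Section PlusMinus.
Variables (R : realType) (V : lmodType R[i]).

Local Notation VC := (complexification (realification V)).

Definition vec_plus (v : V) : VC :=
  (sqrtC 2)^-1 *: (cplx_in (v : realification V) - 'i *: cplx_in (Jop v)).

Definition vec_minus (v : V) : VC :=
  (sqrtC 2)^-1 *: (cplx_in (v : realification V) + 'i *: cplx_in (Jop v)).

Lemma vec_plusE (v : V) : vec_plus v = (sqrtC 2)^-1 *: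
    ((v : realification V, - Jop v) : VC).
Proof.
rewrite [(_, _)]cplx_inE /vec_plus; congr (_ *: (_ + _)).
by rewrite -scalerN; congr (_ *: _); congr (_, _); exact: oppr0.
Qed.

Lemma vec_minusE (v : V) : vec_minus v = (sqrtC 2)^-1 *:
    ((v : realification V, Jop v) : VC).
Proof. by rewrite [(_, _)]cplx_inE. Qed.

Lemma real_rect (a : R[i]) (v : V) :
  a *: v = complex.Re a *: (v : realification V) + complex.Im a *: Jop v.
Proof. by rewrite {1}(complexE a) scalerDl [_ * _]mulrC -scalerA. Qed.

Lemma Jop_rect (a : R[i]) (v : V) :
  Jop (a *: v) = complex.Re a *: Jop v - complex.Im a *: (v : realification V).
Proof.
rewrite /Jop scalerA mulrC -scalerA [LHS]real_rect; congr (_ + _).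
by rewrite /Jop -scalerN scalerA -expr2 sqrCi scaleN1r.
Qed.

Lemma JopD (u v : V) : Jop (u + v) = Jop u + Jop v.
Proof. exact: (scalerDr ('i : R[i]) u v). Qed.

Lemma vec_plus_linear : linear vec_plus.
Proof.
move=> a u v; rewrite !vec_plusE scalerA [a * _]mulrC -scalerA -scalerDr.
congr (_ *: _); congr (_, _) => /=.
  by rewrite scalerN opprK -real_rect.
by rewrite JopD Jop_rect scalerN !opprD opprK.
Qed.

Lemma vec_minus_antilinear a u v :
  vec_minus (a *: u + v) = a^* *: vec_minus u + vec_minus v.
Proof.
rewrite !vec_minusE scalerA [_^* * _]mulrC -scalerA -scalerDr.
congr (_ *: _); case: a => r m; congr (_, _) => /=.
  by rewrite scaleNr opprK [_ *: u]real_rect.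
by rewrite JopD Jop_rect scaleNr.
Qed.

HB.instance Definition _ :=
  GRing.isLinear.Build R[i] V VC *:%R vec_plus vec_plus_linear.
HB.instance Definition _ :=
  GRing.isLinear.Build R[i] V VC (Num.conj \; *:%R) vec_minus
    vec_minus_antilinear.

Definition sym_plus : symalg V -> symalg VC :=
  sym_lift (in_alg (symalg VC)) (fun v => sym_gen (vec_plus v)).

Definition sym_minus : symalg V -> symalg VC :=
  sym_lift (in_alg (symalg VC) \o Num.conj) (fun v => sym_gen (vec_minus v)).

Lemma gen_plusL (a : R[i]) (u v : V) :
  sym_gen (vec_plus (a *: u + v)) =
  in_alg (symalg VC) a * sym_gen (vec_plus u) + sym_gen (vec_plus v).
Proof. by rewrite !linearP /= mulr_algl. Qed.

Lemma gen_minusL (a : R[i]) (u v : V) :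
  sym_gen (vec_minus (a *: u + v)) =
  (in_alg (symalg VC) \o Num.conj) a * sym_gen (vec_minus u) +
  sym_gen (vec_minus v).
Proof. by rewrite vec_minus_antilinear linearP /= mulr_algl. Qed.

Lemma sym_plus_gen v : sym_plus (sym_gen v) = sym_gen (vec_plus v).
Proof. exact: (sym_lift_gen gen_plusL). Qed.

Lemma sym_minus_gen v : sym_minus (sym_gen v) = sym_gen (vec_minus v).
Proof. exact: (sym_lift_gen gen_minusL). Qed.

Lemma sym_plusZ a x : sym_plus (a *: x) = a *: sym_plus x.
Proof. by rewrite -[RHS]mulr_algl; exact: (sym_liftZ gen_plusL). Qed.

Lemma sym_minusZ a x : sym_minus (a *: x) = a^* *: sym_minus x.
Proof. by rewrite -[RHS]mulr_algl; exact: (sym_liftZ gen_minusL). Qed.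

HB.instance Definition _ := GRing.isZmodMorphism.Build (symalg V) (symalg VC)
  sym_plus (sym_lift_zmod gen_plusL).
HB.instance Definition _ := GRing.isMonoidMorphism.Build (symalg V) (symalg VC)
  sym_plus (sym_lift_monoid gen_plusL).
HB.instance Definition _ := GRing.isScalable.Build R[i] (symalg V) (symalg VC)
  *:%R sym_plus sym_plusZ.

HB.instance Definition _ := GRing.isZmodMorphism.Build (symalg V) (symalg VC)
  sym_minus (sym_lift_zmod gen_minusL).
HB.instance Definition _ := GRing.isMonoidMorphism.Build (symalg V) (symalg VC)
  sym_minus (sym_lift_monoid gen_minusL).
HB.instance Definition _ := GRing.isScalable.Build R[i] (symalg V) (symalg VC)
  (Num.conj \; *:%R) sym_minus sym_minusZ.

End PlusMinus.

(* Main.v *)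
From HB Require Import structures.
Require Import Defs.
From mathcomp Require Import all_boot all_order all_algebra complex reals.
From mathcomp Require Import generic_quotient ring_quotient boolp finmap.
From mathcomp.multinomials Require Import -(notations) monalg.

(* Injectivity: w = w_+ + w_- for w in V_C, so a functional killing every
   psi_+ phi_- still does so after composition with multiplication by w, and it
   vanishes by induction over S V_C.
   Surjectivity: a sesquilinear form f on SV must be extended along
   w |-> w_+ (x) 1 + 1 (x) w_-, without a tensor product of algebras. Let Y_w be
   indeterminates indexed by w in V_C over the ring SV, and send a polynomial
   sum_k c_k Y^k to sum_k f(q(Y^k), c_k), where q replaces Y_w by the minus
   component of w. Precomposed with X_w |-> w_+ + Y_w this kills the linear
   relations defining S V_C, and the resulting functional u_f satisfies
     u_f(w x) = u_(f(., w_+ .))(x) + u_(f(w_- ., .))(x),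
   which determines it on products psi_+ phi_- by induction. *)

Set Implicit Arguments.
Unset Strict Implicit.
Unset Printing Implicit Defensive.

Import GRing.Theory Num.Theory.

Local Open Scope ring_scope.

(** * Induction on monomials, polynomials and the symmetric algebra *)

Lemma cmonom_ind (I : choiceType) (Q : cmonom I -> Prop) :
  Q mone -> (forall i m, Q m -> Q (mmul (ucm i) m)) -> forall m, Q m.
Proof.
move=> Q1 QM m; have [n] := ubnP (mdeg m); elim: n m => // n IH m.
have [m0 _|/fset0Pn [i im]] := eqVneq (finsupp m) fset0.
  have -> : m = mone by apply: mdeg_eq0I; rewrite mdegE m0 big_seq_fset0.
  exact: Q1.
(* As [i] lies in the support of [m], the truncated division by [ucm i] is exact. *)
have -> : m = mmul (ucm i) (divcm m (ucm i)).
  apply/eqP/cmP => j; rewrite cmM divcmE cmU subnKC //.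
  by case: eqP => // <-; rewrite lt0n cmE_neq0.
by rewrite mdegM mdegU => /IH /QM.
Qed.

Lemma malg_ind (I : choiceType) (G : zmodType) (Q : malg I G -> Prop) :
  Q 0 -> (forall g h, Q g -> Q h -> Q (g + h)) ->
  (forall k c, Q (mkmalgU k c)) -> forall g, Q g.
Proof.
by move=> Q0 QD QU g; rewrite (monalgE g); apply: (big_ind Q) => // k _.
Qed.

Lemma malgUM (I : monomType) (A : nzRingType) (k l : I) (c d : A) :
  mkmalgU k c * mkmalgU l d = mkmalgU (mmul k l) (c * d).
Proof. by rewrite malgM_def fgmulUU. Qed.

Lemma malgZU (I : choiceType) (A : nzRingType) (k : I) (c d : A) :
  c *: mkmalgU k d = mkmalgU k (c * d).
Proof.
apply/malgP => l; apply: etrans (mcoeffZ c _ l) _.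
by rewrite !mcoeffU mulrnAr.
Qed.

Lemma sym_ind (K : fieldType) (W : lmodType K) (Q : symalg W -> Prop) :
  Q 1 -> (forall x y, Q x -> Q y -> Q (x + y)) ->
  (forall a x, Q x -> Q (a *: x)) ->
  (forall w x, Q x -> Q (sym_gen w * x)) -> forall x, Q x.
Proof.
move=> Q1 QD QZ QM x; rewrite -[x]reprK -/(sym_pi _).
elim/malg_ind: (repr x) => [|g h Qg Qh|k c].
- by rewrite (rmorph0 sym_pi) -(scale0r 1); apply: QZ.
- by rewrite (rmorphD sym_pi); apply: QD.
rewrite -[c]mulr1 -malgZU sym_piZ; apply: QZ.
elim/cmonom_ind: k => [|w m IH].
  by rewrite -[mkmalgU _ _]/(1 : malg (cmonom W) K) (rmorph1 sym_pi).
by rewrite -[1]mulr1 -malgUM (rmorphM sym_pi); apply: QM.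
Qed.

Lemma malg_additive_ext (I : choiceType) (G N : zmodType)
    (F H : malg I G -> N) :
  {morph F : x y / x + y} -> {morph H : x y / x + y} ->
  (forall k c, F (mkmalgU k c) = H (mkmalgU k c)) -> F =1 H.
Proof.
move=> FD HD FH; elim/malg_ind => [|g h IHg IHh|//].
  have e0 (E : malg I G -> N) : {morph E : x y / x + y} -> E 0 = 0.
    by move=> ED; apply: (addrI (E 0)); rewrite -ED !addr0.
  by rewrite !e0.
by rewrite FD HD IHg IHh.
Qed.

(* f descends to the tensor product of the s-conjugate of B with A. *)
Definition balanced (K : fieldType) (s : K -> K) (A B : lmodType K)
    (M : zmodType) (f : B -> A -> M) : Prop :=
  [/\ forall b, {morph f b : a a' / a + a'},
      forall a, {morph f^~ a : b b' / b + b'} &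
      forall k b a, f (s k *: b) a = f b (k *: a)].

(** * Translates of balanced forms by multiplication in either slot *)

Section Forms.
Variables (K : fieldType) (A B : comAlgType K) (M : zmodType) (s : K -> K).

Definition mull_form (b : B) (f : B -> A -> M) : B -> A -> M :=
  fun x y => f (b * x) y.

Definition mulr_form (a : A) (f : B -> A -> M) : B -> A -> M :=
  fun x y => f x (a * y).

Lemma balanced_mull b f : balanced s f -> balanced s (mull_form b f).
Proof.
case=> fr fl fs; split=> [x|x|k x y]; rewrite /mull_form.
- exact: fr.
- by move=> y z; rewrite mulrDr fl.
- by rewrite -scalerAr fs.
Qed.

Lemma balanced_mulr a f : balanced s f -> balanced s (mulr_form a f).
Proof.
case=> fr fl fs; split=> [x|x|k x y]; rewrite /mulr_form.
- by move=> y z; rewrite mulrDr fr.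
- exact: fl.
- by rewrite fs -scalerAr.
Qed.

Lemma balanced0r (f : B -> A -> M) b : balanced s f -> f b 0 = 0.
Proof. by case=> fr _ _; apply: (addrI (f b 0)); rewrite -fr !addr0. Qed.

Lemma balanced0l (f : B -> A -> M) a : balanced s f -> f 0 a = 0.
Proof. by case=> _ fl _; apply: (addrI (f 0 a)); rewrite -fl !addr0. Qed.

End Forms.

(** * Pairing a balanced form with polynomials over [A] *)

Section PolynomialPairing.
Variables (K : fieldType) (W : lmodType K) (A B : comAlgType K) (M : zmodType).
Variables (s : K -> K) (q : W -> B).

Local Notation P := (malg (cmonom W) A).

Definition pairing (f : B -> A -> M) (g : P) : M :=
  \sum_(k <- msupp g) f (monom_eval q k) (mcoeff k g).

Lemma pairing_addf f f1 f2 g : (forall b a, f b a = f1 b a + f2 b a) ->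
  pairing f g = pairing f1 g + pairing f2 g.
Proof.
by move=> ff; rewrite /pairing -big_split; apply: eq_bigr => k _; exact: ff.
Qed.

Section Balanced.
Variable f : B -> A -> M.
Hypothesis fB : balanced s f.

(** Zero coefficients contribute nothing since [f b 0 = 0], so pairings of polynomials with
    different supports can be summed over a common index set. *)
Lemma pairingEw (d : {fset cmonom W}) (g : P) : fsubset (msupp g) d ->
  pairing f g = \sum_(k <- d) f (monom_eval q k) (mcoeff k g).
Proof.
move=> gd; rewrite /pairing (big_fset_incl _ gd) // => k _ /mcoeff_outdom ->.
exact: (balanced0r _ fB).
Qed.

Lemma pairingU k c : pairing f (mkmalgU k c) = f (monom_eval q k) c.
Proof. by rewrite (pairingEw msuppU_le) big_seq_fset1 mcoeffUU. Qed.

Lemma pairing1 : pairing f 1 = f 1 1.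
Proof. by rewrite pairingU (monom_eval_mmorphism q).2. Qed.

Lemma pairingD : {morph pairing f : g h / g + h}.
Proof.
move=> g h; rewrite (pairingEw (msuppD_le g h)).
rewrite (pairingEw (fsubsetUl (msupp g) (msupp h))).
rewrite (pairingEw (fsubsetUr (msupp g) (msupp h))) -big_split /=.
by have [fr _ _] := fB; apply: eq_bigr => k _; rewrite mcoeffD fr.
Qed.

Lemma pairing_mull_additive (g : P) :
  {morph (fun h => pairing f (g * h)) : h h' / h + h'}.
Proof.
move=> h h' /=; apply: etrans (congr1 (pairing f) (mulrDr g h h')) _.
exact: pairingD.
Qed.

End Balanced.

(** By additivity in [g], a single term suffices; a constant factor alters only its coefficient,
    which [f] sees in the second slot. *)
Lemma pairingCM f a g : balanced s f ->
  pairing f (mkmalgU mone a * g) = pairing (mulr_form a f) g.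
Proof.
move=> fB; have gB := balanced_mulr a fB; move: g.
apply: malg_additive_ext.
- exact: pairing_mull_additive.
- exact: pairingD.
move=> k c; rewrite (pairingU gB).
apply: etrans (congr1 (pairing f) (malgUM _ _ _ _)) _.
by rewrite (pairingU fB) mul1m.
Qed.

(** Dually, a variable alters only the monomial, seen by [f] in the first slot through the
    multiplicative substitution [monom_eval q]. *)
Lemma pairingXM f w g : balanced s f ->
  pairing f (mkmalgU (ucm w) 1 * g) = pairing (mull_form (q w) f) g.
Proof.
move=> fB; have gB := balanced_mull (q w) fB; move: g.
apply: malg_additive_ext.
- exact: pairing_mull_additive.
- exact: pairingD.
move=> k c; rewrite (pairingU gB).
apply: etrans (congr1 (pairing f) (malgUM _ _ _ _)) _.
rewrite (pairingU fB) mul1r /mull_form.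
by rewrite (monom_eval_mmorphism q).1 monom_evalU.
Qed.

End PolynomialPairing.

(** * Descent of the pairing to the symmetric algebra *)

Section SymPairing.
Variables (K : fieldType) (W : lmodType K) (A B : comAlgType K) (M : zmodType).
Variables (s : K -> K) (p : W -> A) (q : W -> B).
Hypothesis pL : linear p.
Hypothesis qL : forall a v w, q (a *: v + w) = s a *: q v + q w.

(* P, C, Y and L abstract malg (cmonom W) A, its constants, its variables and
   [pairing]: rewriting in the concrete ring unfolds its definition. *)
Variables (P : comNzRingType) (C : {rmorphism A -> P}) (Y : W -> P).
Variable L : (B -> A -> M) -> P -> M.
Hypothesis L_addf : forall f f1 f2 g,
  (forall b a, f b a = f1 b a + f2 b a) -> L f g = L f1 g + L f2 g.
Hypothesis L1 : forall f, balanced s f -> L f 1 = f 1 1.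
Hypothesis LD : forall f, balanced s f -> {morph L f : g h / g + h}.
Hypothesis LCM : forall f a g, balanced s f ->
  L f (C a * g) = L (mulr_form a f) g.
Hypothesis LXM : forall f w g, balanced s f ->
  L f (Y w * g) = L (mull_form (q w) f) g.

Let split_var (w : W) : P := C (p w) + Y w.

Let split_poly : {rmorphism malg (cmonom W) K -> P} :=
  mmap (C \o in_alg A) (monom_eval split_var).

Let split_polyZ a g : split_poly (a *: g) = C a%:A * split_poly g.
Proof. exact: (@mmapZ _ _ _ (C \o in_alg A) (monom_eval split_var)). Qed.

Let split_poly_var w : split_poly (freecomvar w) = split_var w.
Proof. by rewrite /split_poly /= mmapU monom_evalU /= scale1r rmorph1 mul1r. Qed.

Let L0 f : balanced s f -> L f 0 = 0.
Proof. by move=> fB; apply: (addrI (L f 0)); rewrite -(LD fB) !addr0. Qed.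

(** The constants [C (p w)] cancel because [p] is linear. In the remaining relation between the [Y],
    the scalar [s a] produced by [q] in the first slot of [f] balances the scalar [a] that [C a%:A]
    puts in the second. *)
Let L_relations f g : balanced s f ->
  linear_relations g -> L f (split_poly g) = 0.
Proof.
move=> fB; elim=> [|h {}g a v w _ IH]; first by rewrite rmorph0 L0.
rewrite rmorphD (LD fB) IH addr0 rmorphM rmorphB rmorphD split_polyZ.
move: (freecomvar v) (freecomvar w) (freecomvar _) (split_poly_var v)
  (split_poly_var w) (split_poly_var (a *: v + w)) => x y z -> -> ->.
have -> : split_var (a *: v + w) - (C a%:A * split_var v + split_var w) =
    Y (a *: v + w) - (C a%:A * Y v + Y w).
  rewrite /split_var mulrDr -rmorphM pL mulr_algl rmorphD.
  by rewrite [X in _ - X]addrACA opprD addrACA subrr add0r.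
move: (split_poly h) => {}h; rewrite mulrC.
(* Only additivity of [L f] is given, so the subtracted term is moved to the other side. *)
apply: (addIr (L f ((C a%:A * Y v + Y w) * h))).
rewrite -(LD fB) -mulrDl subrK add0r mulrDl (LD fB) -mulrA.
rewrite (LCM _ _ fB) !LXM //; last exact: balanced_mulr.
apply: L_addf => b c; have [_ fl fs] := fB.
by rewrite /mulr_form /mull_form qL mulrDl fl -scalerAl fs mulr_algl.
Qed.

Let u f (x : symalg W) : M := L f (split_poly (repr x)).

(** Two representatives differ by an element of the ideal, on which [L f] vanishes after the
    substitution. *)
Let u_pi f g : balanced s f -> u f (sym_pi g) = L f (split_poly g).
Proof.
move=> fB; rewrite /u -[X in split_poly X](subrK g) rmorphD (LD fB).
rewrite L_relations ?add0r //.
suff : repr (sym_pi g) - g \in sym_ideal by move/asboolP.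
by rewrite Quotient.idealrBE reprK.
Qed.

(** A single [u] serves all forms, since the recursion on the argument replaces [f] by its
    translates. [M] carries no scalars, so scaling is expressed through the second slot of [f]. *)
Lemma sym_pairing_of_model : exists u : (B -> A -> M) -> symalg W -> M,
  forall f, balanced s f ->
  [/\ {morph u f : x y / x + y}, u f 1 = f 1 1,
      forall a x, u f (a *: x) = u (mulr_form a%:A f) x &
      forall w x, u f (sym_gen w * x) =
        u (mulr_form (p w) f) x + u (mull_form (q w) f) x].
Proof.
exists u => f fB; split=> [x y||a x|w x].
- rewrite -[x]reprK -[y]reprK -!/(sym_pi _) -(rmorphD sym_pi) !u_pi //.
  by rewrite rmorphD (LD fB).
- by rewrite -(rmorph1 sym_pi) u_pi // rmorph1 L1.
- have gB := balanced_mulr a%:A fB.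
  rewrite -[x]reprK -!/(sym_pi _) -sym_piZ !u_pi //.
  by rewrite split_polyZ LCM.
have [gB hB] := (balanced_mulr (p w) fB, balanced_mull (q w) fB).
rewrite -[x]reprK -!/(sym_pi _) -(rmorphM sym_pi) !u_pi // rmorphM.
rewrite [split_poly _]split_poly_var.
by rewrite mulrDl (LD fB) (LCM _ _ fB) (LXM _ _ fB).
Qed.

End SymPairing.

Lemma sym_pairing (K : fieldType) (W : lmodType K) (A B : comAlgType K)
    (M : zmodType) (s : K -> K) (p : W -> A) (q : W -> B) :
  linear p -> (forall a v w, q (a *: v + w) = s a *: q v + q w) ->
  exists u : (B -> A -> M) -> symalg W -> M,
  forall f, balanced s f ->
  [/\ {morph u f : x y / x + y}, u f 1 = f 1 1,
      forall a x, u f (a *: x) = u (mulr_form a%:A f) x &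
      forall w x, u f (sym_gen w * x) =
        u (mulr_form (p w) f) x + u (mull_form (q w) f) x].
Proof.
move=> pL qL.
pose C : {rmorphism A -> malg (cmonom W) A} := @mkmalgU (cmonom W) A mone.
apply: (@sym_pairing_of_model _ _ _ _ _ s _ _ pL qL (malg (cmonom W) A)
  C (fun w => mkmalgU (ucm w) 1) (pairing q)).
- exact: pairing_addf.
- exact: pairing1.
- exact: pairingD.
- exact: pairingCM.
- exact: pairingXM.
Qed.

(** * Projections of [V_C] onto its plus and minus components *)

(** Only [j * j = -1] matters: [j = 'i] gives linearity of [proj_plus], and [j = - 'i] antilinearity
    of [proj_minus]. *)
Lemma scale_rect (K : comNzRingType) (U : lmodType K) (j r m : K)
    (x y x' y' : U) : j * j = -1 ->
  (r *: x - m *: y + x') + j *: (r *: y + m *: x + y') =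
  (r + j * m) *: (x + j *: y) + (x' + j *: y').
Proof.
move=> jj; rewrite [j *: (_ + y')]scalerDr addrACA; congr (_ + _).
rewrite scalerDl !scalerDr !scalerA [r * j]mulrC mulrAC jj mulN1r scaleNr.
by rewrite -!addrA; congr (_ + _); rewrite addrC -addrA.
Qed.

Section Projections.
Variables (R : realType) (V : lmodType R[i]).

Local Notation VC := (complexification (realification V)).
Local Notation r2 := ((sqrtC 2)^-1 : R[i]).

(** The plus component of [e], read back as a vector of [V] through [vec_plus]. *)
Definition proj_plus (e : VC) : V := r2 *: ((e.1 : V) + 'i *: (e.2 : V)).

Definition proj_minus (e : VC) : V := r2 *: ((e.1 : V) + (- 'i) *: (e.2 : V)).

Lemma r2_sqr : r2 * r2 = 2^-1.
Proof. by rewrite -invfM -expr2 sqrtCK. Qed.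

(** Needed because [vec_minus] and [proj_minus] conjugate the normalising factor. *)
Lemma r2_conj : r2^* = r2.
Proof. by rewrite geC0_conj // invr_ge0 sqrtC_ge0. Qed.

Lemma scale_r2_double (U : lmodType R[i]) (x : U) :
  r2 *: (r2 *: (x + x)) = x.
Proof.
rewrite scalerA r2_sqr -mulr2n -[x *+ 2]scaler_nat scalerA mulVf ?scale1r //.
by rewrite pnatr_eq0.
Qed.

Lemma proj_plus_linear : linear proj_plus.
Proof.
move=> a [x y] [x' y']; rewrite /proj_plus.
rewrite [a *: (r2 *: _)]scalerA [a * _]mulrC -scalerA -scalerDr; congr (_ *: _).
rewrite [in RHS](complexE a) complexiE.
by apply: (@scale_rect _ V 'i); rewrite -expr2 sqrCi.
Qed.

Lemma proj_minus_antilinear a e e' :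
  proj_minus (a *: e + e') = a^* *: proj_minus e + proj_minus e'.
Proof.
move: e e' => [x y] [x' y']; rewrite /proj_minus.
rewrite [a^* *: (r2 *: _)]scalerA [a^* * _]mulrC -scalerA -scalerDr.
congr (_ *: _).
have -> : a^* = ((complex.Re a)%:C + - 'i * (complex.Im a)%:C)%C :> R[i].
  rewrite (complexE a^*) complexiE; case: a => r m /=.
  by rewrite rmorphN mulrN mulNr.
by apply: (@scale_rect _ V (- 'i)); rewrite mulrNN -expr2 sqrCi.
Qed.

HB.instance Definition _ :=
  GRing.isLinear.Build R[i] VC V *:%R proj_plus proj_plus_linear.
HB.instance Definition _ :=
  GRing.isLinear.Build R[i] VC V (Num.conj \; *:%R) proj_minus
    proj_minus_antilinear.

Lemma scale_iJ (v : V) : 'i *: (Jop v : V) = - v.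
Proof. by rewrite /Jop scalerA -expr2 sqrCi scaleN1r. Qed.

Lemma proj_plusK : cancel (@vec_plus R V) proj_plus.
Proof.
move=> v; rewrite vec_plusE linearZ /= /proj_plus /=.
by rewrite scalerN scale_iJ opprK scale_r2_double.
Qed.

Lemma proj_minusK : cancel (@vec_minus R V) proj_minus.
Proof.
move=> v; rewrite vec_minusE linearZ /= r2_conj /proj_minus /=.
by rewrite scaleNr scale_iJ opprK scale_r2_double.
Qed.

Lemma proj_plus_minus v : proj_plus (vec_minus v) = 0.
Proof.
rewrite vec_minusE linearZ /= /proj_plus /= scale_iJ.
by rewrite subrr !scaler0.
Qed.

Lemma proj_minus_plus v : proj_minus (vec_plus v) = 0.
Proof.
rewrite vec_plusE linearZ /= /proj_minus /= scaleNr scalerN opprK scale_iJ.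
by rewrite subrr !scaler0.
Qed.

Lemma vec_plus_minus_split e :
  vec_plus (proj_plus e) + vec_minus (proj_minus e) = e.
Proof.
have E1 (x y : V) : x + 'i *: y + (x + - 'i *: y) = x + x.
  by rewrite scaleNr addrACA subrr addr0.
have E2 (x y : V) : - ('i *: (x + 'i *: y)) + 'i *: (x + - 'i *: y) = y + y.
  rewrite !scalerDr opprD addrACA addNr add0r !scalerA mulrN -expr2 sqrCi.
  by rewrite opprK scaleN1r opprK scale1r.
case: e => x y; rewrite /proj_plus /proj_minus !linearZ /= r2_conj.
rewrite vec_plusE vec_minusE -!scalerDr -[RHS](@scale_r2_double VC).
by congr (_ *: (_ *: _)); congr (_, _); [exact: E1 | exact: E2].
Qed.

End Projections.

(** * Existence and uniqueness of extensions from products *)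

(* V, W, S, T stand for V, V_C, SV, S V_C, and genS, genT for sym_gen; the
   algebras are abstract because rewriting in symalg unfolds the quotient. *)
Section AbstractSplitting.
Variables (K : fieldType) (s : K -> K).
Hypothesis ss : involutive s.
Variables (V W : lmodType K) (S T : comAlgType K).
Variables (genS : V -> S) (genT : W -> T).
Hypothesis S_ind : forall Q : S -> Prop,
  Q 1 -> (forall x y, Q x -> Q y -> Q (x + y)) ->
  (forall a x, Q x -> Q (a *: x)) ->
  (forall w x, Q x -> Q (genS w * x)) -> forall x, Q x.
Hypothesis T_ind : forall Q : T -> Prop,
  Q 1 -> (forall x y, Q x -> Q y -> Q (x + y)) ->
  (forall a x, Q x -> Q (a *: x)) ->
  (forall w x, Q x -> Q (genT w * x)) -> forall x, Q x.
Variables (plusV minusV : V -> W) (p q : W -> V).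
Variables (plusS minusS : S -> T).
Hypothesis genS0 : genS 0 = 0.
Hypothesis genTD : {morph genT : v w / v + w}.
Hypothesis plusS1 : plusS 1 = 1.
Hypothesis plusSD : {morph plusS : x y / x + y}.
Hypothesis plusSZ : forall a x, plusS (a *: x) = a *: plusS x.
Hypothesis plusS_genM : forall v x,
  plusS (genS v * x) = genT (plusV v) * plusS x.
Hypothesis minusS1 : minusS 1 = 1.
Hypothesis minusSD : {morph minusS : x y / x + y}.
Hypothesis minusSZ : forall a x, minusS (a *: x) = s a *: minusS x.
Hypothesis minusS_genM : forall v x,
  minusS (genS v * x) = genT (minusV v) * minusS x.
Hypothesis p_plus : cancel plusV p.
Hypothesis q_minus : cancel minusV q.
Hypothesis p_minus : forall v, p (minusV v) = 0.
Hypothesis q_plus : forall v, q (plusV v) = 0.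
Hypothesis splitW : forall w, plusV (p w) + minusV (q w) = w.

Section Extension.
Variables (M : zmodType) (u : (S -> S -> M) -> T -> M).
Hypothesis uP : forall f, balanced s f ->
  [/\ {morph u f : x y / x + y}, u f 1 = f 1 1,
      forall a x, u f (a *: x) = u (mulr_form a%:A f) x &
      forall w x, u f (genT w * x) =
        u (mulr_form (genS (p w)) f) x + u (mull_form (genS (q w)) f) x].

(** The relation between [f] and [f'] is inherited by their translates, so the induction runs over
    all such pairs. With [t] a multiplication by a conjugate scalar it yields antilinearity of the
    extension. *)
Lemma extension_comp (t : M -> M) f f' x :
  {morph t : y z / y + z} -> balanced s f -> balanced s f' ->
  (forall b a, f' b a = t (f b a)) -> u f' x = t (u f x).
Proof.
move=> tD.
elim/T_ind: x f f' => [|x y IHx IHy|a x IH|w x IH] f f' fB gB ff;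
  have [uD u1 uZ ugen] := uP fB; have [vD v1 vZ vgen] := uP gB.
- by rewrite u1 v1.
- by rewrite uD vD tD (IHx f) // (IHy f).
- by rewrite uZ vZ; apply: IH => [||b c]; [exact: balanced_mulr..|exact: ff].
rewrite ugen vgen tD; congr (_ + _); apply: IH => [||b c] //.
- exact: balanced_mulr.
- exact: balanced_mulr.
- exact: ff.
- exact: balanced_mull.
- exact: balanced_mull.
- exact: ff.
Qed.

(** On a generator [minusV v] the plus term of the recursion vanishes, so all factors accumulate in
    the first slot. *)
Lemma extension_minus f phi : balanced s f -> u f (minusS phi) = f phi 1.
Proof.
elim/S_ind: phi f => [|x y IHx IHy|a x IH|v x IH] f fB;
  have [uD u1 uZ ugen] := uP fB; have [fr fl fs] := fB.
- by rewrite minusS1.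
- by rewrite minusSD uD IHx // IHy // fl.
- rewrite minusSZ uZ IH; last exact: balanced_mulr.
  (* Moving [s a] from the second slot to the first applies [s] again, which restores [a]. *)
  by rewrite /mulr_form mulr1 -fs ss.
rewrite minusS_genM ugen !IH; [|exact: balanced_mull|exact: balanced_mulr].
by rewrite /mulr_form /mull_form p_minus q_minus genS0 mul0r
  (balanced0r _ fB) add0r.
Qed.

(** Plus generators, having no minus component, are peeled off into the second slot until
    [extension_minus] applies. *)
Lemma extension_plus_minus f phi psi : balanced s f ->
  u f (plusS psi * minusS phi) = f phi psi.
Proof.
elim/S_ind: psi f => [|x y IHx IHy|a x IH|v x IH] f fB;
  have [uD u1 uZ ugen] := uP fB; have [fr fl fs] := fB.
- by rewrite plusS1 mul1r extension_minus.
- by rewrite plusSD mulrDl uD IHx // IHy // fr.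
- rewrite plusSZ -scalerAl uZ IH; last exact: balanced_mulr.
  by rewrite /mulr_form mulr_algl.
rewrite plusS_genM -mulrA ugen !IH;
  [|exact: balanced_mull|exact: balanced_mulr].
by rewrite /mulr_form /mull_form q_plus p_plus genS0 mul0r
  (balanced0l _ fB) addr0.
Qed.

End Extension.

Lemma semilinear_form_eq0 (h : T -> K) :
  {morph h : x y / x + y} -> (forall a x, h (a *: x) = s a * h x) ->
  (forall psi phi, h (plusS psi * minusS phi) = 0) -> forall x, h x = 0.
Proof.
move=> hD hZ h0 x.
elim/T_ind: x h hD hZ h0 => [|x y IHx IHy|a x IH|w x IH] h hD hZ h0.
- by rewrite -[1]mul1r -[X in X * _]plusS1 -minusS1 h0.
- by rewrite hD IHx // IHy // addr0.
- by rewrite hZ IH // mulr0.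
(* This functional still kills the products: the plus part of [w] is absorbed into [psi], the minus
   part into [phi]. *)
apply: (IH (fun y => h (genT w * y))) => [y z|a y|psi phi].
- by rewrite mulrDr hD.
- by rewrite -scalerAr hZ.
rewrite -{1}(splitW w) genTD mulrDl hD mulrA -plusS_genM h0.
by rewrite mulrCA -minusS_genM h0 addr0.
Qed.

End AbstractSplitting.

(** * The correspondence between functionals and linear maps *)

Section Isomorphism.
Variables (R : realType) (V : lmodType R[i]).

Local Notation VC := (complexification (realification V)).

Lemma sym_plus_genM (v : V) x :
  sym_plus (sym_gen v * x) = sym_gen (vec_plus v) * sym_plus x.
Proof.
apply: etrans (rmorphM (@sym_plus R V) (sym_gen v) x) _.
exact: (congr1 (fun y => y * sym_plus x) (sym_plus_gen v)).
Qed.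

Lemma sym_minus_genM (v : V) x :
  sym_minus (sym_gen v * x) = sym_gen (vec_minus v) * sym_minus x.
Proof.
apply: etrans (rmorphM (@sym_minus R V) (sym_gen v) x) _.
exact: (congr1 (fun y => y * sym_minus x) (sym_minus_gen v)).
Qed.

Lemma balanced_hom (F : linHom (symalg V) (antidual (symalg V))) :
  balanced Num.conj (fun phi psi => F phi psi : R[i]).
Proof.
split=> [b a a'|a b b'|k b a].
- exact: (raddfD (F b)).
- exact: (congr1 (fun g : antidual (symalg V) => g a) (raddfD F b b')).
- apply: etrans (congr1 (fun g : antidual (symalg V) => g a)
    (linearZ_LR F _ _)) _.
  exact: (esym (linearZ_LR (F b) k a)).
Qed.

Lemma antidual_extension (F : linHom (symalg V) (antidual (symalg V))) :
  exists u : antidual (symalg VC),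
    forall phi psi, u (sym_plus psi * sym_minus phi) = F phi psi.
Proof.
have pL : linear (fun w : VC => sym_gen (proj_plus w)).
  by move=> a v w; rewrite !linearP.
have qL a (v w : VC) : sym_gen (proj_minus (a *: v + w)) =
    a^* *: sym_gen (proj_minus v) + sym_gen (proj_minus w).
  by rewrite proj_minus_antilinear linearP.
have [u uP] := sym_pairing R[i] pL qL.
have ext := @extension_plus_minus R[i] Num.conj conjCK V VC (symalg V)
  (symalg VC) (@sym_gen _ _) (@sym_gen _ _) (@sym_ind _ _)
  (@vec_plus R V) (@vec_minus R V) (@proj_plus R V) (@proj_minus R V)
  (@sym_plus R V) (@sym_minus R V) (linear0 _)
  (rmorph1 _) (rmorphD _) (@sym_plusZ R V) sym_plus_genM
  (rmorph1 _) (rmorphD _) (@sym_minusZ R V) sym_minus_genM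
  (@proj_plusK R V) (@proj_minusK R V) (@proj_plus_minus R V)
  (@proj_minus_plus R V) R[i] u uP.
have comp := @extension_comp R[i] Num.conj V VC (symalg V)
  (symalg VC) (@sym_gen _ _) (@sym_gen _ _) (@sym_ind _ _)
  (@proj_plus R V) (@proj_minus R V) R[i] u uP.
pose f phi psi : R[i] := F phi psi.
have fB : balanced Num.conj f := balanced_hom F.
(* Scaling [x] translates [f] in its second slot, where [F b] is antilinear; the translate is thus
   [a^*] times [f], and [comp] extracts the factor. *)
have uZ a x : u f (a *: x) = a^* * u f x.
  have [_ _ -> _] := uP f fB; apply: (comp ( *%R a^*)).
  - exact: mulrDr.
  - exact: fB.
  - exact: balanced_mulr.
  move=> b c; rewrite /mulr_form /f mulr_algl.
  exact: (linearZ_LR (F b) a c).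
have uL : u f \in @semilinear_fun R[i] Num.conj (symalg VC) (R[i])^o.
  apply/asboolP => a x y; have [uD _ _ _] := uP f fB.
  by apply: etrans (uD _ _) _; congr (_ + _); exact: uZ.
by exists (Semihom uL) => phi psi; exact: ext.
Qed.

Lemma antidual_ext (u u' : antidual (symalg VC)) :
  (forall phi psi, u (sym_plus psi * sym_minus phi) =
    u' (sym_plus psi * sym_minus phi)) -> u = u'.
Proof.
move=> uu'; apply/val_inj/funext => x; apply/eqP; rewrite -subr_eq0; apply/eqP.
apply: (@semilinear_form_eq0 R[i] Num.conj V VC (symalg V)
  (symalg VC) (@sym_gen _ _) (@sym_gen _ _) (@sym_ind _ _)
  (@vec_plus R V) (@vec_minus R V) (@proj_plus R V) (@proj_minus R V)
  (@sym_plus R V) (@sym_minus R V) (raddfD _)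
  (rmorph1 _) sym_plus_genM (rmorph1 _) sym_minus_genM
  (@vec_plus_minus_split R V) (fun x => u x - u' x)) => [y z|a y|psi phi].
- by rewrite (raddfD u) (raddfD u') opprD addrACA.
- rewrite mulrBr; congr (_ - _); exact: linearZ_LR.
- by rewrite uu' subrr.
Qed.

Lemma pairing_form_antilinear (u : antidual (symalg VC)) (phi : symalg V) :
  (fun psi => u (sym_plus psi * sym_minus phi))
    \in @semilinear_fun R[i] Num.conj (symalg V) (R[i])^o.
Proof.
apply/asboolP => a x y.
apply: etrans (semihomP u a _ _); congr (u _).
by rewrite linearP mulrDl -scalerAl.
Qed.

(** The conjugations from [sym_minus] and from [u] cancel, which leaves linearity in [phi]. *)
Lemma pairing_form_linear (u : antidual (symalg VC)) :
  (fun phi => Semihom (pairing_form_antilinear u phi) : antidual (symalg V))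
    \in @semilinear_fun R[i] idfun (symalg V) (antidual (symalg V)).
Proof.
apply/asboolP => a x y; apply/val_inj/funext => psi.
have E : sym_plus psi * sym_minus (a *: x + y) =
    a^* *: (sym_plus psi * sym_minus x) + sym_plus psi * sym_minus y.
  apply: etrans (congr1 ( *%R (sym_plus psi)) (linearP _ a x y)) _.
  apply: etrans (mulrDr _ _ _) _.
  by congr (_ + _); exact: (esym (scalerAr _ _ _)).
apply: etrans (congr1 u E) _; apply: etrans (semihomP u _ _ _) _.
exact: (congr1 (fun c : R[i] => c *: (u _ : (R[i])^o) + _) (conjCK a)).
Qed.

Definition pairing_form (u : antidual (symalg VC)) :
  linHom (symalg V) (antidual (symalg V)) := Semihom (pairing_form_linear u).

Lemma pairing_form_is_linear : linear pairing_form.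
Proof.
by move=> a u u'; apply/val_inj/funext => phi; apply/val_inj/funext => psi.
Qed.

HB.instance Definition _ :=
  GRing.isLinear.Build R[i] (antidual (symalg VC))
    (linHom (symalg V) (antidual (symalg V))) *:%R pairing_form pairing_form_is_linear.

End Isomorphism.

Theorem theorem1 (R : realType) (V : complexHilbertType R) :
  exists T : {linear antidual (symalg (complexification (realification V))) ->
                     linHom (symalg V) (antidual (symalg V))},
    bijective T /\
    forall (u : antidual (symalg (complexification (realification V))))
           (phi psi : symalg V),
      T u phi psi = u (sym_plus psi * sym_minus phi).
Proof.
exists (@pairing_form R V); split=> //.
(* A chosen extension of each [F] gives the inverse map: a right inverse by construction, a left
   inverse by [antidual_ext]. *)
have /choice [g gP] := @antidual_extension R V.
exists g => [u|F]; last first.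
  by apply/val_inj/funext => phi; apply/val_inj/funext => psi; exact: gP.
by apply: antidual_ext => phi psi; exact: gP.
Qed.
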